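(* Let $n\geq 8$ be an integer. The minimum coprime number of the cube $C_n^3$ of the cycle is given by $$\mathfrak{pr}(C_n^3)=\begin{cases} 6k-1 & \text{if } n=4k, \\ 6k+1 & \text{if } n=4k+1,\\ 6k+5 & \text{if } n=4k+2,\\ 6k+7 & \text{if } n=4k+3, \end{cases}$$ where $k$ is an integer.
   Context: $C_n$ is the cycle on $n$ vertices. The $k$-th power $G^k$ of a graph $G$ has the same vertex set as $G$, with an edge between distinct $u,v$ whenever the distance $d(u,v)$ in $G$ is at most $k$. All graphs are finite and simple. A coprime labeling of a graph $G$ of order $N$ is an assignment of distinct labels from $\{1,\ldots,M\}$, for some integer $M\ge N$, to the vertices of $G$ such that adjacent vertices receive relatively prime labels. The minimum coprime number $\mathfrak{pr}(G)$ is the minimum value $M$ for which such a labeling exists. *)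

(* Defs.v *)
From mathcomp Require Import all_boot.

Set Implicit Arguments.
Unset Strict Implicit.
Unset Printing Implicit Defensive.

Record sgraph := SGraph {
  vertex :> finType;
  adj : rel vertex;
  adj_sym : symmetric adj;
  adj_irr : irreflexive adj }.

Section Distance.
Variable G : sgraph.
Implicit Types u v : G.

Definition has_walk u v (d : nat) : bool :=
  [exists p : d.-tuple G, path (@adj G) u p && (last u p == v)].

(* A shortest walk between connected vertices has length less than #|G|, so
   this is the least length of a walk from u to v. It is the junk value #|G|
   when u and v are not connected. *)
Definition dist u v : nat := find (has_walk u v) (iota 0 #|G|).

Definition power_adj (k : nat) : rel G :=
  fun u v => [&& u != v, connect (@adj G) u v & dist u v <= k].

Lemma has_walkC u v d : has_walk u v d = has_walk v u d.
Proof.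
suff W x y : has_walk x y d -> has_walk y x d by apply/idP/idP; apply: W.
case/existsP=> p /andP[pth /eqP lst].
have sz : size (rev (belast x p)) == d by rewrite size_rev size_belast size_tuple.
apply/existsP; exists (Tuple sz) => /=.
have -> : path (@adj G) y (rev (belast x p)).
  rewrite -lst rev_path; apply: sub_path pth => a b.
  by rewrite adj_sym.
case: (tval p) lst => [|z s] /= lst; first by rewrite lst.
by rewrite rev_cons last_rcons.
Qed.

Lemma power_adj_sym k : symmetric (power_adj k).
Proof.
move=> u v; rewrite /power_adj eq_sym (sym_connect_sym (@adj_sym G)).
by congr [&& _, _ & _ <= _]; apply: eq_find => d; rewrite has_walkC.
Qed.

Lemma power_adj_irr k : irreflexive (power_adj k).
Proof. by move=> u; rewrite /power_adj eqxx. Qed.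

Definition power (k : nat) : sgraph :=
  SGraph (@power_adj_sym k) (@power_adj_irr k).

End Distance.

Section Cycle.
Variable n : nat.

(* ordS is the successor modulo n; the condition i != j only matters for
   n = 1. This is the usual n-cycle for n >= 3. *)
Definition cycle_adj : rel 'I_n :=
  fun i j => (i != j) && ((j == ordS i) || (i == ordS j)).

Lemma cycle_adj_sym : symmetric cycle_adj.
Proof. by move=> i j; rewrite /cycle_adj eq_sym orbC. Qed.

Lemma cycle_adj_irr : irreflexive cycle_adj.
Proof. by move=> i; rewrite /cycle_adj eqxx. Qed.

Definition cycle_graph : sgraph := SGraph cycle_adj_sym cycle_adj_irr.

End Cycle.

Section CoprimeLabeling.
Variable G : sgraph.

Definition coprime_labeling (M : nat) (f : {ffun G -> 'I_M.+1}) : bool :=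
  [&& injectiveb f, [forall v, 0 < f v] &
      [forall u, forall v, adj u v ==> coprime (f u) (f v)]].

Definition coprime_labelable (M : nat) : bool :=
  (#|G| <= M) && [exists f : {ffun G -> 'I_M.+1}, coprime_labeling f].

(* Label the vertices with distinct primes. *)
Lemma coprime_labelable_ex : exists M, coprime_labelable M.
Proof.
pose q i := iter i (fun p => s2val (prime_above p)) 2.
have q_pr i : prime (q i).
  by case: i => [|i] //=; case: (prime_above _).
have q_lt : {homo q : i j / i < j}.
  apply: homo_ltn; first exact: ltn_trans.
  by move=> i /=; case: (prime_above _).
have q_inj i j : q i = q j -> i = j.
  by move=> eq_q; case: (ltngtP i j) => // /q_lt; rewrite eq_q ltnn.
pose M := maxn #|G| (q #|G|).
have q_le (v : G) : q (enum_rank v) < M.+1.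
  by rewrite ltnS (leq_trans _ (leq_maxr _ _)) // ltnW // q_lt.
exists M; rewrite /coprime_labelable leq_maxl.
apply/existsP; exists [ffun v => Ordinal (q_le v)].
apply/and3P; split.
- apply/injectiveP => u v; rewrite !ffunE => /(congr1 val) /= /q_inj.
  by move/val_inj/enum_rank_inj.
- by apply/forallP => v; rewrite ffunE /= prime_gt0.
apply/forallP => u; apply/forallP => v; apply/implyP => uv.
rewrite !ffunE /= prime_coprime // dvdn_prime2 //.
apply/eqP => /q_inj/val_inj/enum_rank_inj eq_uv.
by rewrite eq_uv adj_irr in uv.
Qed.

Definition min_coprime_number : nat := ex_minn coprime_labelable_ex.

End CoprimeLabeling.

(* Main.v *)
Require Import Defs.
From mathcomp Require Import all_boot.
From mathcomp Require Import zify.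

Set Implicit Arguments.
Unset Strict Implicit.
Unset Printing Implicit Defensive.

(** In the cube of the [n]-cycle, two vertices are adjacent when they are at most
    three steps apart on the cycle, so an independent set has at most [n %/ 4]
    vertices ([independent_card]).

    Lower bound. The vertices with even labels form an independent set, and so do
    those whose labels are multiples of 3. With [m = n %/ 4], at least [n - 2m]
    labels are therefore coprime to 6. Integers coprime to 6 are told apart by
    their quotient by 3 (1, 5, 7, 11, ... have the quotients 0, 1, 2, 3, ...), so
    one of these labels has a quotient by 3 of at least [n - 2m - 1]
    ([coprime_labeling_large]); the least integer coprime to 6 with that
    property is the number in the theorem.

    Upper bound. Label the cycle by the blocks [6i+1, e_i, 6i+3, 6i+5] for
    [i < m], followed by as many of [6m+1, 6m+5, 6m+7] as are needed. Labels at
    most three places apart differ by at most 10, so 2, 3, 5 and 7 are the only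
    primes they could share ([coprime_near]). The multiples of 3 and the even
    labels each occur once per block, always in the same place, which handles 2
    and 3; the even label [e_i] is usually [6i+2], and is moved to a close number
    when 5 or 7 would be shared with a neighbour. Where the cycle closes up, the
    first three labels are 1, 2 and 3; the label 2 meets the last two places,
    which hold odd labels, and 3 meets the last place only, whose label is
    coprime to 6 ([label_coprime_wrap]). *)

(** * Adjacency in powers of a cycle *)

(** Each step of a walk goes forwards or backwards by one; [a] and [b] count the
    two kinds, so that no subtraction modulo [n] is needed. *)
Lemma cycle_walk_mod n (u : 'I_n) (p : seq 'I_n) :
  path (@cycle_adj n) u p ->
  exists a b, a + b = size p /\ u + a = last u p + b %[mod n].
Proof.
elim: p u => [|w p IH] u /=; first by exists 0, 0.
case/andP=> /andP[_ uw] /IH[a [b [<- eq_ab]]].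
case/orP: uw => /eqP E.
- exists a.+1, b; split=> //.
  by rewrite -eq_ab E /= modnDml addSnnS.
- exists a, b.+1; split; first by rewrite addnS.
  by apply/eqP; rewrite E /= modnDml addSnnS -addSnnS addSn -addn1 -[b.+1]addn1
    addnA eqn_modDr eq_ab.
Qed.

Lemma dist_le_has_walk (G : sgraph) (u v : G) k :
  k < #|G| -> dist u v <= k -> exists2 d, d <= k & has_walk u v d.
Proof.
move=> ltk led; have lt : dist u v < #|G| by apply: leq_ltn_trans ltk.
exists (dist u v) => //.
have := lt; rewrite /dist -{2}(size_iota 0 #|G|) -has_find => /(nth_find 0).
by rewrite nth_iota.
Qed.

Lemma has_walk_dist_le (G : sgraph) (u v : G) k d :
  k < #|G| -> d <= k -> has_walk u v d -> dist u v <= k.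
Proof.
move=> ltk led W; rewrite leqNgt; apply/negP => lt.
have ltd : d < dist u v by apply: leq_ltn_trans lt.
have := before_find 0 ltd.
by rewrite nth_iota ?W //; apply: leq_ltn_trans ltk.
Qed.

Lemma power_cycle_adj_mod n k (u v : power (cycle_graph n) k) :
  k < n -> adj u v ->
  exists2 d, 0 < d <= k &
    (v : 'I_n) = (u : 'I_n) + d %[mod n] \/ (u : 'I_n) = (v : 'I_n) + d %[mod n].
Proof.
move=> ltk /and3P[neq_uv _ led].
have ltk' : k < #|cycle_graph n| by rewrite card_ord.
have [d led' /existsP[p /andP[pth /eqP lst]]] := dist_le_has_walk ltk' led.
have [a [b [sz eq_ab]]] := cycle_walk_mod pth.
rewrite lst in eq_ab; rewrite size_tuple in sz.
have neq : (u : 'I_n) <> v :> nat by move/val_inj/eqP; rewrite (negbTE neq_uv).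
have ltu := ltn_ord u; have ltv := ltn_ord v.
have neq_ab : a <> b.
  move=> E; move/eqP: eq_ab; rewrite E eqn_modDr !modn_small //.
  by move/eqP.
case: (ltngtP a b) neq_ab => // ltab _.
- exists (b - a); first lia.
  right; apply/eqP; rewrite -(eqn_modDr a) eq_ab -addnA subnK //; exact: ltnW.
- exists (a - b); first lia.
  left; apply/eqP; rewrite -(eqn_modDr b) -eq_ab -addnA subnK //; exact: ltnW.
Qed.

Lemma val_iter_ordS n (u : 'I_n) d : iter d (@ordS n) u = (u + d) %% n :> nat.
Proof.
elim: d => [|d IH] /=; first by rewrite addn0 modn_small.
by rewrite IH -addn1 modnDml addn1 addnS.
Qed.

Lemma power_cycle_adj_shift n k (u v : power (cycle_graph n) k) d :
  1 < n -> k < n -> d <= k -> u != v ->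
  (v : 'I_n) = (u : 'I_n) + d %[mod n] -> adj u v.
Proof.
move=> lt1 ltk led neq_uv eq_v.
pose p := traject (@ordS n) (ordS u) d.
have pth : path (@cycle_adj n) u p.
  apply: sub_path (fpath_traject _ _ _) => x y /eqP <-.
  rewrite /cycle_adj eqxx andbT -val_eqE /=.
  have ltx := ltn_ord x.
  have [ltx1|ltx1] := ltnP x.+1 n; first by rewrite modn_small //; lia.
  have -> : x.+1 = n by lia.
  by rewrite modnn; lia.
have lst : last u p = v.
  rewrite last_traject; apply: val_inj; rewrite /= val_iter_ordS -eq_v modn_small //.
have sz : size p == d by rewrite size_traject.
apply/and3P; split=> //; first by apply/connectP; exists p.
apply: (has_walk_dist_le _ led); first by rewrite card_ord.
by apply/existsP; exists (Tuple sz); rewrite /= pth lst eqxx.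
Qed.

(** The arcs of [k.+1] consecutive vertices that start at the vertices of an
    independent set are pairwise disjoint. *)
Lemma independent_card n k (S : {set power (cycle_graph n) k}) :
  k < n -> {in S &, forall u v, ~~ adj u v} -> #|S| <= n %/ k.+1.
Proof.
move=> ltk indep; rewrite leq_divRL //.
have n_gt0 : 0 < n by lia.
have [->|[w wS]] := set_0Vmem S; first by rewrite cards0.
have ltm x : x %% n < n by rewrite ltn_mod.
pose g (x : 'I_n * 'I_k.+1) := Ordinal (ltm (x.1 + x.2)).
have inj : {in setX S [set: 'I_k.+1] &, injective g}.
  (* u + a = v + b with a <= b makes u a shift of v by b - a <= k. *)
  suff W (u v : 'I_n) (a b : 'I_k.+1) : u \in S -> v \in S -> a <= b ->
      g (u, a) = g (v, b) -> (u, a) = (v, b).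
    move=> [u a] [v b]; rewrite !inE /= !andbT => uS vS E.
    have [ab|/ltnW ba] := leqP a b; first exact: W.
    by apply/esym/W.
  move=> uS vS leab /(congr1 val) /= E.
  have [ltu ltv lta ltb] := And4 (ltn_ord u) (ltn_ord v) (ltn_ord a) (ltn_ord b).
  have Euv : u = v + (b - a) %[mod n].
    by apply/eqP; rewrite -(eqn_modDr a) -addnA subnK // E.
  have [eq_uv|neq_uv] := eqVneq v u; last first.
    suff : adj (v : power (cycle_graph n) k) u by rewrite (negbTE (indep v u vS uS)).
    have lt1 : 1 < n by move: neq_uv ltu ltv; rewrite -val_eqE /=; clear; lia.
    by apply: (@power_cycle_adj_shift _ _ _ _ (b - a)) => //; lia.
  subst v; congr pair; apply: val_inj => /=.
  move/eqP: E; rewrite eqn_modDl !modn_small; by [move/eqP|lia].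
have := card_in_imset inj; rewrite cardsX cardsT !card_ord => <-.
by rewrite -[X in _ <= X](card_ord n) max_card.
Qed.

(** * The lower bound *)

Lemma coprime_labeling_multiples n k M q
    (f : {ffun power (cycle_graph n) k -> 'I_M.+1}) :
  k < n -> 1 < q -> coprime_labeling f ->
  #|[set v | q %| f v]| <= n %/ k.+1.
Proof.
move=> ltk q_gt1 /and3P[_ _ /forallP cop]; apply: independent_card => // u v.
rewrite !inE => qu qv; apply/negP => uv.
move/forallP/(_ v)/implyP/(_ uv)/eqP: (cop u) => E.
by have := dvdn_gcd q (f u) (f v); rewrite E qu qv dvdn1; lia.
Qed.

(** Outside the multiples of 2 and of 3 there remain more than [m] vertices, and
    the quotient by 3 is injective on integers coprime to 6, so these quotients
    cannot all be below [m]. *)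
Lemma coprime_labeling_large n k M
    (f : {ffun power (cycle_graph n) k -> 'I_M.+1}) :
  k < n -> coprime_labeling f ->
  forall m, 2 * (n %/ k.+1) + m < n ->
  exists v, [/\ ~~ (2 %| f v), ~~ (3 %| f v) & m <= f v %/ 3].
Proof.
move=> ltk cf m ltm.
have c2 := @coprime_labeling_multiples _ _ _ 2 _ ltk isT cf.
have c3 := @coprime_labeling_multiples _ _ _ 3 _ ltk isT cf.
pose A := ~: ([set v | 2 %| f v] :|: [set v | 3 %| f v]).
have cA : m < #|A|.
  have cU := (leq_card_setU [set v | 2 %| f v] [set v | 3 %| f v]).1.
  have := cardsC ([set v | 2 %| f v] :|: [set v | 3 %| f v]).
  rewrite -/A card_ord; move: c2 c3 cU ltm.
  move: (n %/ _) #|_ :|: _| #|A| #|_| #|[set v | 3 %| f v]|; clear; lia.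
have injA : {in A &, injective (fun v => f v %/ 3)}.
  move=> u v; rewrite !inE => uA vA E; case/and3P: cf => /injectiveP inj _ _.
  by apply/inj/val_inj; move: uA vA E => /=; lia.
have [/existsP[v /andP[vA le]]|/existsPn small] :=
  boolP [exists v, (v \in A) && (m <= f v %/ 3)].
  by exists v; move: vA; rewrite !inE negb_or => /andP[].
exfalso.
have m_gt0 : 0 < m.
  have /card_gt0P[v vA] : 0 < #|A| by lia.
  by have := small v; rewrite vA; lia.
case: m m_gt0 ltm cA small => // m _ _ cA small.
pose g v : 'I_m.+1 := inord (f v %/ 3).
have injg : {in A &, injective g}.
  move=> u v uA vA /(congr1 val); have := small u; have := small v.
  by rewrite uA vA /= -!leqNgt => hv hu; rewrite !inordK ?ltnS // => /injA->.
have := card_in_imset injg => E.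
have := max_card (mem (g @: A)); rewrite E card_ord; lia.
Qed.

(** * The labeling *)

(** In the second place of block [i], an even label has the neighbours
    [6i-3, 6i-1, 6i+1, 6i+3, 6i+5, 6i+7]. The choice [6i+2] is at distances 1, 3
    and 5 from them, hence fails only if 5 divides it, that is if [i] is 3 modulo
    5. The choice [6i+4] then fails only if 7 divides it, that is if [i] is 4
    modulo 7, and in that case neither 5 nor 7 divides [6i-2]. The value [6i-2]
    is not used by the previous block, where it would be the second choice,
    because [i-1] is not 3 modulo 5. *)
Definition even_label i :=
  if i %% 5 != 3 then 6 * i + 2 else if i %% 7 != 4 then 6 * i + 4 else 6 * i - 2.

(** The blocks are followed by [6m+1] in place [4m], then by [6m+5] and [6m+7]:
    the value [6m+3] is skipped, since the blocks already contain [m] multiples of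
    3, which is as many as a cycle with fewer than [4m+4] vertices admits. *)
Definition label m p :=
  if p <= 4 * m then
    nth 0 [:: 6 * (p %/ 4) + 1; even_label (p %/ 4); 6 * (p %/ 4) + 3;
              6 * (p %/ 4) + 5] (p %% 4)
  else 6 * m + 5 + 2 * (p - (4 * m + 1)).

(** One constructor per residue of the place modulo 4 and per choice of the even
    label, so that properties of the labeling become linear arithmetic with
    constant moduli. *)
Variant label_spec m : nat -> nat -> Prop :=
| LabelOne i of i <= m : label_spec m (4 * i) (6 * i + 1)
| LabelEven2 i of i < m & i %% 5 <> 3 : label_spec m (4 * i + 1) (6 * i + 2)
| LabelEven4 i of i < m & i %% 5 = 3 & i %% 7 <> 4 :
    label_spec m (4 * i + 1) (6 * i + 4)
| LabelEvenPred i of 0 < i < m & i %% 5 = 3 & i %% 7 = 4 :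
    label_spec m (4 * i + 1) (6 * i - 2)
| LabelThree i of i < m : label_spec m (4 * i + 2) (6 * i + 3)
| LabelFive i of i < m : label_spec m (4 * i + 3) (6 * i + 5)
| LabelTail j : label_spec m (4 * m + 1 + j) (6 * m + 5 + 2 * j).

Lemma labelP m p : label_spec m p (label m p).
Proof.
rewrite /label; have [le|lt] := leqP p (4 * m); last first.
  rewrite {1}(_ : p = 4 * m + 1 + (p - (4 * m + 1))); first by constructor.
  lia.
have E := divn_eq p 4; have lt4 : p %% 4 < 4 by rewrite ltn_mod.
rewrite {1}E mulnC.
case: (p %% 4) lt4 E => [|[|[|[|]]]] //= _ E; rewrite ?addn0;
  try by constructor; lia.
rewrite /even_label; case: eqP => /= E5; last by apply: LabelEven2 => //; lia.
by case: eqP => /= E7; [apply: LabelEvenPred | apply: LabelEven4] => //; lia.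
Qed.

(** A common prime factor divides the difference, which is at most 10. *)
Lemma coprime_near x y :
  0 < x -> x < y <= x + 10 \/ y < x <= y + 10 ->
  all (fun q => ~~ ((q %| x) && (q %| y))) [:: 2; 3; 5; 7] -> coprime x y.
Proof.
move=> x_gt0 near no; rewrite /coprime -[_ == 1]negbK; apply/negP => g_neq1.
have g_gt0 : 0 < gcdn x y by rewrite gcdn_gt0 x_gt0.
have q_pr : prime (pdiv (gcdn x y)) by apply: pdiv_prime; lia.
have := pdiv_dvd (gcdn x y); move: (pdiv _) q_pr => q q_pr.
rewrite dvdn_gcd => /andP[qx qy].
have le10 : q <= 10.
  case: near => /andP[lt le].
  - have := dvdn_sub qy qx => /dvdn_leq; lia.
  - have := dvdn_sub qx qy => /dvdn_leq; lia.
have : q \in [:: 2; 3; 5; 7].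
  by move: q q_pr le10 {qx qy}; do 11 case=> //.
by move=> q_in; move/allP/(_ q q_in): no; rewrite qx qy.
Qed.

Lemma label_gt0 m p : 0 < label m p.
Proof. by case: labelP => *; lia. Qed.

Lemma label_inj m : injective (label m).
Proof. by move=> p q; case: (labelP m p); case: (labelP m q) => *; lia. Qed.

Lemma label_coprime_near m p q :
  p < q <= p + 3 -> q < 4 * m + 4 -> coprime (label m p) (label m q).
Proof.
move=> near lt; apply: coprime_near; first exact: label_gt0.
  by move: near lt; case: (labelP m p); case: (labelP m q) => *; lia.
rewrite /= andbT; apply/and4P.
by split; move: near lt; case: (labelP m p); case: (labelP m q) => *; lia.
Qed.

(** Here [p] is one of the first three places, labelled 1, 2 and 3. Whichever
    residue [n] has modulo 4, the last two labels are odd and the last one is not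
    a multiple of 3. *)
Lemma label_coprime_wrap m n p q :
  1 < m -> 4 * m <= n < 4 * m + 4 ->
  q < n -> n + p <= q + 3 -> coprime (label m p) (label m q).
Proof.
move=> m_gt1 n4 lt le.
have [p0|[p1|p2]] : p = 0 \/ p = 1 \/ p = 2 by lia.
- by subst p; rewrite /label muln0 /= coprime1n.
- subst p; have -> : label m 1 = 2 by rewrite /label /even_label /= ifT //; lia.
  by rewrite prime_coprime //; move: lt le; case: (labelP m q) => *; lia.
- subst p; have -> : label m 2 = 3 by rewrite /label /= ifT //; lia.
  by rewrite prime_coprime //; move: lt le; case: (labelP m q) => *; lia.
Qed.

Lemma coprime_labelable_cube n M :
  8 <= n <= M -> (forall p, p < n -> label (n %/ 4) p <= M) ->
  coprime_labelable (power (cycle_graph n) 3) M.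
Proof.
case/andP=> n_ge8 leM bound; rewrite /coprime_labelable card_ord leM /=.
pose f : {ffun power (cycle_graph n) 3 -> 'I_M.+1} :=
  [ffun v : 'I_n => inord (label (n %/ 4) v)].
have fE (v : 'I_n) : f v = label (n %/ 4) v :> nat.
  by rewrite ffunE inordK // ltnS bound.
apply/existsP; exists f; apply/and3P; split.
- apply/injectiveP => u v /(congr1 val) /=.
  by rewrite !fE => /label_inj/val_inj.
- by apply/forallP => v; rewrite fE label_gt0.
apply/forallP => u; apply/forallP => v; apply/implyP => uv.
rewrite !fE.
(* The shift either stays in the linear order of the labels or passes 0. *)
have W (x y : 'I_n) d : 0 < d <= 3 -> y = x + d %[mod n] ->
    coprime (label (n %/ 4) x) (label (n %/ 4) y).
  move=> hd; have ltx := ltn_ord x; have lty := ltn_ord y.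
  rewrite (modn_small lty).
  have [lt|le] := ltnP (x + d) n.
    by rewrite modn_small // => ->; apply: label_coprime_near; lia.
  rewrite -[x + d](subnK le) modnDr modn_small; last lia.
  move=> E; rewrite coprime_sym; apply: (@label_coprime_wrap _ n); lia.
have n_gt3 : 3 < n by lia.
have [d hd [E|E]] := power_cycle_adj_mod n_gt3 uv; first exact: W hd E.
by rewrite coprime_sym; apply: W hd E.
Qed.

Lemma coprime_labelable_large n k M :
  k < n -> coprime_labelable (power (cycle_graph n) k) M ->
  forall m, 2 * (n %/ k.+1) + m < n ->
  exists x, [/\ x <= M, ~~ (2 %| x), ~~ (3 %| x) & m <= x %/ 3].
Proof.
move=> ltk /andP[_ /existsP[f cf]] m ltm.
have [v [v2 v3 le]] := coprime_labeling_large ltk cf ltm.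
by exists (f v); rewrite -ltnS ltn_ord.
Qed.

(** This reduces the theorem to arithmetic: [M] bounds the labels in use, and it
    is at most every integer coprime to 6 that has the quotient by 3 forced by
    [coprime_labelable_large]. *)
Lemma min_coprime_number_cube n M :
  8 <= n <= M -> (forall p, p < n -> label (n %/ 4) p <= M) ->
  (forall x, ~~ (2 %| x) -> ~~ (3 %| x) ->
     n - 2 * (n %/ 4) - 1 <= x %/ 3 -> M <= x) ->
  min_coprime_number (power (cycle_graph n) 3) = M.
Proof.
move=> hn upper lower; rewrite /min_coprime_number; case: ex_minnP => L cL minL.
apply/eqP; rewrite eqn_leq minL /=; last exact: coprime_labelable_cube.
have n_gt3 : 3 < n by lia.
have lt : 2 * (n %/ 4) + (n - 2 * (n %/ 4) - 1) < n by lia.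
have [x [leL x2 x3 lex]] := coprime_labelable_large n_gt3 cL lt.
by apply: leq_trans leL; apply: lower.
Qed.

Theorem theorem21 (n : nat) (hn : 8 <= n) (k : nat) :
  [/\ n = 4 * k -> min_coprime_number (power (cycle_graph n) 3) = 6 * k - 1,
      n = 4 * k + 1 -> min_coprime_number (power (cycle_graph n) 3) = 6 * k + 1,
      n = 4 * k + 2 -> min_coprime_number (power (cycle_graph n) 3) = 6 * k + 5
    & n = 4 * k + 3 -> min_coprime_number (power (cycle_graph n) 3) = 6 * k + 7].
Proof.
split=> def_n; have kE : n %/ 4 = k by lia.
all: apply: min_coprime_number_cube; rewrite ?kE; try lia.
all: by move=> p; case: labelP => *; lia.
Qed.
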